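(* Let $\bm{f}(\mathbf{x};\sigma)\in\mathbb{R}^d$, $\mathbf{x}\in\mathbb{R}^d$, be the drift function of the ODE $\frac{\mathrm{d}\mathbf{x}_\sigma}{\mathrm{d}\sigma}=\bm{f}(\mathbf{x}_\sigma;\sigma)$, and let $\mathbf{x}_{\sigma_i}^{\mathrm{Heun}},\mathbf{x}_{\sigma_i}^{\mathrm{Euler}}\in\mathbb{R}^d$ be the Heun and Euler states at noise level $\sigma_i$. Let $J_{\sigma_i}$ be the Jacobian matrix, with respect to $\mathbf{x}$, of $\bm{f}(\cdot;\sigma_i)$ evaluated at $\mathbf{x}_{\sigma_i}^{\mathrm{Heun}}$. Assume that $\bm{f}(\cdot;\sigma_i)$ has a locally Lipschitz Jacobian near $\mathbf{x}_{\sigma_i}^{\mathrm{Heun}}$. If the difference $\Delta^{\mathbf{x}}:=\mathbf{x}_{\sigma_i}^{\mathrm{Heun}}-\mathbf{x}_{\sigma_i}^{\mathrm{Euler}}$ is a nonzero vector, sufficiently small, and aligned with the eigenvector associated with the eigenvalue $\lambda$ of $J_{\sigma_i}$ that is dominant (largest) in magnitude, in the sense that $$\big\|J_{\sigma_i}(\mathbf{x}_{\sigma_i}^{\mathrm{Heun}}-\mathbf{x}_{\sigma_i}^{\mathrm{Euler}})\big\|_2=|\lambda|\,\big\|\mathbf{x}_{\sigma_i}^{\mathrm{Heun}}-\mathbf{x}_{\sigma_i}^{\mathrm{Euler}}\big\|_2+\mathcal{O}\big(\|\Delta^{\mathbf{x}}\|_2^2\big),$$ then the magnitude of the dominant eigenvalue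 satisfies $$|\lambda|=\frac{\big\|\bm{f}(\mathbf{x}_{\sigma_i}^{\mathrm{Heun}};\sigma_i)-\bm{f}(\mathbf{x}_{\sigma_i}^{\mathrm{Euler}};\sigma_i)\big\|_2}{\big\|\mathbf{x}_{\sigma_i}^{\mathrm{Heun}}-\mathbf{x}_{\sigma_i}^{\mathrm{Euler}}\big\|_2}+\mathcal{O}\big(\|\Delta^{\mathbf{x}}\|_2\big).$$
   Context: Noise levels are discretized as a decreasing sequence $\sigma_0>\sigma_1>\dots>\sigma_N=0$. Starting from a state $\mathbf{x}_{\sigma_{i-1}}$ at noise level $\sigma_{i-1}$, with step size $h=\sigma_{i-1}-\sigma_i>0$, the Euler and Heun states at $\sigma_i$ are $$\mathbf{x}_{\sigma_i}^{\mathrm{Euler}}=\mathbf{x}_{\sigma_{i-1}}-h\,\bm{f}(\mathbf{x}_{\sigma_{i-1}};\sigma_{i-1}),\qquad \mathbf{x}_{\sigma_i}^{\mathrm{Heun}}=\mathbf{x}_{\sigma_{i-1}}-\tfrac{h}{2}\big(\bm{f}(\mathbf{x}_{\sigma_{i-1}};\sigma_{i-1})+\bm{f}(\mathbf{x}_{\sigma_i}^{\mathrm{Euler}};\sigma_i)\big).$$ $\|\cdot\|_2$ is the Euclidean norm. ''Locally Lipschitz Jacobian near $\mathbf{x}_{\sigma_i}^{\mathrm{Heun}}$'' means that $\bm{f}(\cdot;\sigma_i)$ is differentiable on some ball centered at $\mathbf{x}_{\sigma_i}^{\mathrm{Heun}}$ and its Jacobian is Lipschitz there with some constant $L$; ''sufficiently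 small'' means in particular that $\mathbf{x}_{\sigma_i}^{\mathrm{Euler}}$ lies in this ball. The $\mathcal{O}$ terms are understood as $\Delta^{\mathbf{x}}\to 0$: the hypothesis means that the two sides differ by at most $C\|\Delta^{\mathbf{x}}\|_2^2$ for a constant $C$ independent of $\Delta^{\mathbf{x}}$, and the conclusion means that the two sides differ by at most $C'\|\Delta^{\mathbf{x}}\|_2$ for a constant $C'$ depending only on $C$ and $L$. *)

(* Defs.v *)
From mathcomp Require Import all_boot all_order all_algebra.
From mathcomp Require Import all_classical all_reals all_analysis.
From mathcomp Require Import complex.

Set Implicit Arguments.
Unset Strict Implicit.
Unset Printing Implicit Defensive.

Import Order.TTheory GRing.Theory Num.Theory numFieldNormedType.Exports.

Local Open Scope classical_set_scope.
Local Open Scope ring_scope.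

(* The library norm `|x| on 'rV[R]_d is the sup norm, so the Euclidean norm is
   defined here. The two norms induce the same topology, hence the library's
   [differentiable] and ['d] are the usual ones. *)
Definition norm2 (R : realType) (d : nat) (x : 'rV[R]_d) : R :=
  Num.sqrt (\sum_(j < d) x ord0 j ^+ 2).

Definition ball2 (R : realType) (d : nat) (x : 'rV[R]_d) (r : R) :
    set 'rV[R]_d :=
  [set y | norm2 (y - x) < r].

(* Vectors are rows and matrices act on the right: [jacobian g x] is the
   transpose of the matrix of partial derivatives, and [v *m jacobian g x] is
   the textbook product J v. Accordingly [eigenvalue], which is defined by
   v *m A = a *: v, refers to the textbook (right) eigenvectors of J. *)
Definition opnorm2 (R : realType) (d : nat) (A : 'M[R]_d) : R :=
  sup [set norm2 (v *m A) | v in [set v : 'rV[R]_d | norm2 v <= 1]].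

Definition lipschitz_jacobian_on (R : realType) (d : nat)
    (g : 'rV[R]_d -> 'rV[R]_d) (B : set 'rV[R]_d) (L : R) : Prop :=
  (forall x, B x -> differentiable g x) /\
  (forall x y, B x -> B y ->
     opnorm2 (jacobian g x - jacobian g y) <= L * norm2 (x - y)).

(* A real matrix may have non-real eigenvalues, so dominance is taken over the
   complex spectrum. *)
Definition complex_eigenvalue (R : realType) (d : nat) (A : 'M[R]_d)
    (lambda : R[i]) : Prop :=
  eigenvalue (map_mx (real_complex R) A) lambda.

(* The order of R[i] compares only numbers with equal imaginary parts; on
   moduli, which are real, it is the order of R. *)
Definition dominant_eigenvalue (R : realType) (d : nat) (A : 'M[R]_d)
    (lambda : R[i]) : Prop :=
  complex_eigenvalue A lambda /\
  (forall mu : R[i], complex_eigenvalue A mu -> `|mu| <= `|lambda|).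

(* The norm of R[i] is R[i]-valued. *)
Definition modulus (R : realType) (z : R[i]) : R := complex.Re `|z|.

Definition euler_step (R : realType) (d : nat)
    (f : 'rV[R]_d -> R -> 'rV[R]_d) (s t : R) (x : 'rV[R]_d) : 'rV[R]_d :=
  x - (s - t) *: f x s.

Definition heun_step (R : realType) (d : nat)
    (f : 'rV[R]_d -> R -> 'rV[R]_d) (s t : R) (x : 'rV[R]_d) : 'rV[R]_d :=
  x - ((s - t) / 2) *: (f x s + f (euler_step f s t x) t).

(* Main.v *)
Require Import Defs.
From mathcomp Require Import all_boot all_order all_algebra.
From mathcomp Require Import all_classical all_reals all_analysis.
From mathcomp Require Import complex.
From mathcomp Require Import ring lra.

Import Order.TTheory GRing.Theory Num.Theory numFieldNormedType.Exports.

Local Open Scope classical_set_scope.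
Local Open Scope ring_scope.

(* The remainder w of the first-order expansion of f at the Heun state
   satisfies |w| <= L |Delta|^2. To get this without integrating the Jacobian
   along a segment, apply the scalar mean value theorem to the component of
   f - J in the direction w itself, which turns the increment into |w|^2.
   The triangle inequality and the alignment hypothesis then give
   C' = C + L. *)

Definition dot {R : realType} {d : nat} (u w : 'rV[R]_d) : R :=
  \sum_(j < d) u ord0 j * w ord0 j.

Section Euclidean.
Context {R : realType} {d : nat}.
Implicit Types (u v w : 'rV[R]_d) (A : 'M[R]_d).

Lemma dotDl u v w : dot (u + v) w = dot u w + dot v w.
Proof. by rewrite -big_split; apply: eq_bigr => j _; rewrite mxE mulrDl. Qed.

Lemma dotZl (k : R) u w : dot (k *: u) w = k * dot u w.
Proof. by rewrite mulr_sumr; apply: eq_bigr => j _; rewrite mxE mulrA. Qed.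

Lemma dotC u w : dot u w = dot w u.
Proof. by apply: eq_bigr => j _; rewrite mulrC. Qed.

Lemma dotBl u v w : dot (u - v) w = dot u w - dot v w.
Proof. by rewrite dotDl -scaleN1r dotZl mulN1r. Qed.

Lemma norm2_ge0 u : 0 <= norm2 u.
Proof. exact: sqrtr_ge0. Qed.

Lemma sqr_norm2 u : norm2 u ^+ 2 = dot u u.
Proof.
rewrite sqr_sqrtr; last by apply: sumr_ge0 => j _; exact: sqr_ge0.
by apply: eq_bigr => j _; rewrite expr2.
Qed.

Lemma norm2_eq0 u : (norm2 u == 0) = (u == 0).
Proof.
apply/eqP/eqP => [u0|->]; last first.
  by rewrite /norm2 big1 ?sqrtr0// => j _; rewrite mxE expr0n.
have : dot u u = 0 by rewrite -sqr_norm2 u0 expr0n.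
move/eqP; rewrite psumr_eq0 => [|j _]; last by rewrite -expr2 sqr_ge0.
move=> /allP u0j; apply/rowP => j; rewrite mxE.
by apply/eqP; have := u0j j (mem_index_enum j); rewrite /= mulf_eq0 orbb.
Qed.

Lemma norm2Z (k : R) u : norm2 (k *: u) = `|k| * norm2 u.
Proof.
apply/eqP; rewrite -(@eqrXn2 _ 2)// ?mulr_ge0 ?norm2_ge0//; apply/eqP.
by rewrite exprMn !sqr_norm2 dotZl dotC dotZl real_normK ?num_real// mulrA expr2.
Qed.

Lemma norm2N u : norm2 (- u) = norm2 u.
Proof. by rewrite -scaleN1r norm2Z normrN1 mul1r. Qed.

(** Cauchy-Schwarz: the quadratic $t \mapsto \|u - t w\|_2^2$ is nonnegative, and for nonzero [w]
    its value at the minimizer [dot u w / dot w w], multiplied by [dot w w], is the difference of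
    the two sides. *)
Lemma sqr_dot_le u w : dot u w ^+ 2 <= norm2 u ^+ 2 * norm2 w ^+ 2.
Proof.
rewrite !sqr_norm2.
have q t : 0 <= dot u u - 2 * t * dot u w + t ^+ 2 * dot w w.
  have := sqr_ge0 (norm2 (u - t *: w)).
  rewrite sqr_norm2 dotBl dotZl ![dot _ (u - _)]dotC !dotBl !dotZl.
  by rewrite (dotC w u); congr (is_true (0 <= _)); ring.
have [w0|w0] := eqVneq w 0.
  suff -> : dot u w = 0 by rewrite expr0n mulr_ge0// -sqr_norm2 sqr_ge0.
  by rewrite dotC w0 -(scale0r 0) dotZl mul0r.
have ww : 0 < dot w w.
  by rewrite -sqr_norm2 exprn_gt0// lt_def norm2_eq0 w0 norm2_ge0.
have := q (dot u w / dot w w); rewrite -(pmulr_lge0 _ ww).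
rewrite -(subr_ge0 (dot u w ^+ 2)); congr (is_true (0 <= _)); field.
by rewrite gt_eqF.
Qed.

Lemma dot_le u w : dot u w <= norm2 u * norm2 w.
Proof.
apply: le_trans (ler_norm _) _.
rewrite -(@ler_pXn2r _ 2) ?nnegrE ?mulr_ge0 ?norm2_ge0//.
by rewrite real_normK ?num_real// exprMn sqr_dot_le.
Qed.

Lemma norm2D u v : norm2 (u + v) <= norm2 u + norm2 v.
Proof.
rewrite -(@ler_pXn2r _ 2) ?nnegrE ?addr_ge0 ?norm2_ge0//.
rewrite sqr_norm2 dotDl ![dot _ (u + v)]dotC !dotDl sqrrD !sqr_norm2.
by have := dot_le u v; rewrite (dotC v u); lra.
Qed.

Lemma norm2_dist u v : `|norm2 u - norm2 v| <= norm2 (u - v).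
Proof.
rewrite ler_norml; apply/andP; split.
  have := norm2D (v - u) u; rewrite subrK -(norm2N (v - u)) opprB; lra.
by have := norm2D (u - v) v; rewrite subrK; lra.
Qed.

(** Cauchy-Schwarz on each column of [A], that is, each row of [A^T]; the factor on the right is the
    Frobenius norm. It serves to show that the supremum in [opnorm2] is over a bounded set. *)
Lemma norm2_mulmx_frobenius v A :
  norm2 (v *m A) <=
  norm2 v * Num.sqrt (\sum_(j < d) norm2 (row j A^T) ^+ 2).
Proof.
have F0 : 0 <= \sum_(j < d) norm2 (row j A^T) ^+ 2.
  by apply: sumr_ge0 => j _; exact: sqr_ge0.
rewrite -(@ler_pXn2r _ 2) ?nnegrE ?mulr_ge0 ?norm2_ge0 ?sqrtr_ge0//.
rewrite exprMn (sqr_sqrtr F0) sqr_norm2 mulr_sumr; apply: ler_sum => j _.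
rewrite -expr2; apply: le_trans (sqr_dot_le _ _).
by rewrite mxE /dot; under [X in _ <= X ^+ 2]eq_bigr do rewrite !mxE.
Qed.

(** Boundedness matters because [sup] takes a default value on unbounded sets; with it, [opnorm2 A]
    really bounds each [norm2 (v *m A)] with [v] in the unit ball. *)
Lemma has_ubound_opnorm2 A :
  has_ubound [set norm2 (v *m A) | v in [set v | norm2 v <= 1]].
Proof.
exists (Num.sqrt (\sum_(j < d) norm2 (row j A^T) ^+ 2)) => _ [v v1 <-].
by apply: le_trans (norm2_mulmx_frobenius v A) _; rewrite ler_piMl ?sqrtr_ge0.
Qed.

Lemma opnorm2_ge0 A : 0 <= opnorm2 A.
Proof.
apply: ub_le_sup (has_ubound_opnorm2 A) _ _; exists 0 => /=.
  by have /eqP -> : norm2 (0 : 'rV[R]_d) == 0 by rewrite norm2_eq0.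
by apply/eqP; rewrite norm2_eq0 mul0mx.
Qed.

Lemma norm2_mulmx v A : norm2 (v *m A) <= opnorm2 A * norm2 v.
Proof.
have [->|v0] := eqVneq v 0.
  have /eqP -> : norm2 (0 *m A) == 0 by rewrite norm2_eq0 mul0mx.
  by rewrite mulr_ge0 ?norm2_ge0 ?opnorm2_ge0.
have nv : 0 < norm2 v by rewrite lt_def norm2_eq0 v0 norm2_ge0.
have nV : 0 <= (norm2 v)^-1 by rewrite invr_ge0 ltW.
rewrite -ler_pdivrMr//; apply: ub_le_sup (has_ubound_opnorm2 A) _ _.
exists ((norm2 v)^-1 *: v) => /=; first by rewrite norm2Z ger0_norm// mulVf// gt_eqF.
by rewrite -scalemxAl norm2Z ger0_norm// mulrC.
Qed.

(** Chain rule: the line has velocity [v], which the differential of [g] sends to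
    [v *m jacobian g _]. Pairing with the fixed [w] makes the function real-valued, as the mean
    value theorem requires. *)
Lemma is_derive_dot_line (g : 'rV[R]_d -> 'rV[R]_d) (a v w : 'rV[R]_d) (t : R) :
  differentiable g (t *: v + a) ->
  is_derive t 1 (fun s : R => dot (g (s *: v + a)) w)
    (dot (v *m jacobian g (t *: v + a)) w).
Proof.
move=> dg; pose M s := g (s *: v + a).
have dl : is_diff t (fun s : R => s *: v + a) ( *:%R^~ v).
  apply: is_diff_eq (is_diffD (is_diff_scalel t v) (is_diff_cst a t)) _.
  by rewrite addr0.
have dM := is_diff_comp dl (differentiableP dg).
have MJ : is_derive t 1 M (v *m jacobian g (t *: v + a)).
  have [dfM dME] := dM; apply: DeriveDef; first exact: diff_derivable.
  by rewrite deriveE// dME /= scale1r -deriveEjacobian// deriveE.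
(* As a linear combination of coordinate functions with constant coefficients, the pairing can be
   differentiated term by term. *)
have -> : (fun s : R => dot (M s) w)
    = \sum_(j < d) (w ord0 j \*: (fun s => M s ord0 j)).
  by apply/funext => s; rewrite fct_sumE; apply: eq_bigr => j _; exact: mulrC.
rewrite dotC.
apply: is_derive_sum => j; apply: is_deriveZ; apply: DeriveDef.
  by have /derivable_mxP := @ex_derive _ _ _ _ _ _ _ MJ; exact.
have := derive_mx (@ex_derive _ _ _ _ _ _ _ MJ).
by rewrite derive_val => ->; rewrite mxE.
Qed.

(** The mean value theorem places the Jacobian at a single point of the segment from [y] to [x].
    Bounding the distance from that point to [x] by the full length of the segment gives the
    constant [L], rather than the [L / 2] of an integral argument. *)
Lemma lipschitz_jacobian_remainder (g : 'rV[R]_d -> 'rV[R]_d) (x y : 'rV[R]_d)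
    (r L : R) :
  lipschitz_jacobian_on g (ball2 x r) L -> ball2 x r y ->
  norm2 (g x - g y - (x - y) *m jacobian g x) <= L * norm2 (x - y) ^+ 2.
Proof.
move=> [dg lip] By; set v := x - y; set J := jacobian g x.
set w := g x - g y - v *m J.
have nv : norm2 v < r by rewrite /v -norm2N opprB.
have Bx : ball2 x r x.
  rewrite /ball2 /= subrr.
  have /eqP -> : norm2 (0 : 'rV[R]_d) == 0 by rewrite norm2_eq0.
  exact: le_lt_trans (norm2_ge0 v) nv.
(* The segment runs from [y] at [t = 0] to the centre [x] at [t = 1], so it stays in the ball. *)
have segE (t : R) : t *: v + y - x = (t - 1) *: v.
  by rewrite scalerBl scale1r /v opprB addrA.
have segn (t : R) : t \in `[0, 1] -> norm2 (t *: v + y - x) <= norm2 v.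
  rewrite in_itv/= => /andP[t0 t1]; rewrite segE norm2Z.
  by rewrite ler_piMl ?norm2_ge0// ler_norml; apply/andP; split; lra.
have segB (t : R) : t \in `[0, 1] -> ball2 x r (t *: v + y).
  by move=> t01; exact: le_lt_trans (segn t t01) nv.
(* Removing the linear part makes the increment of [phi] over the unit interval equal to [dot w w],
   and leaves in the derivative only the variation of the Jacobian. *)
pose phi (t : R) : R := dot (g (t *: v + y)) w - dot (v *m J) w * t.
pose dphi (t : R) : R := dot (v *m (jacobian g (t *: v + y) - J)) w.
have dphiP (t : R) : t \in `[0, 1] -> is_derive t 1 phi (dphi t).
  move=> t01; have dl := is_derive_dot_line g y v w t (dg _ (segB t t01)).
  have dr := is_deriveZ (dot (v *m J) w) (is_derive_id t (1 : R)).
  apply: is_derive_eq (is_deriveB dl dr) _.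
  by rewrite /dphi mulmxBr dotBl; congr (_ - _); exact: mulr1.
have cphi : {within `[0, 1], continuous phi}.
  apply: derivable_within_continuous => t t01.
  exact: (@ex_derive _ _ _ _ _ _ _ (dphiP t t01)).
have phi_oo (t : R) : t \in `]0, 1[ -> is_derive t 1 phi (dphi t).
  by move=> t01; apply: dphiP; exact: subset_itv_oo_cc.
have [c c01] := MVT_segment ler01 phi_oo cphi.
have -> : phi 1 - phi 0 = norm2 w ^+ 2.
  have vy : v + y = x by rewrite /v subrK.
  rewrite /phi scale1r scale0r add0r vy mulr0 subr0 mulr1 sqr_norm2.
  have -> : dot w w = dot (g x) w - dot (g y) w - dot (v *m J) w.
    by rewrite -!dotBl.
  by ring.
rewrite subr0 mulr1 => wE.
(* The sign comes from the Lipschitz bound itself, whose left side is an operator norm. *)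
have L0 : L * norm2 v >= 0.
  exact: le_trans (opnorm2_ge0 _) (lip x y Bx By).
have step : dphi c <= L * norm2 v ^+ 2 * norm2 w.
  apply: le_trans (dot_le _ _) _; rewrite ler_wpM2r ?norm2_ge0//.
  apply: le_trans (norm2_mulmx _ _) _.
  rewrite expr2 mulrA ler_wpM2r ?norm2_ge0//.
  apply: le_trans (lip _ _ (segB c c01) Bx) _.
  (* The point at [c] lies at distance [|c - 1| * norm2 v] from [x], and the first factor is at most
     1. *)
  rewrite segE norm2Z mulrCA ler_piMl//.
  by move: c01; rewrite in_itv/= => /andP[? ?]; rewrite ler_norml; apply/andP; split; lra.
(* It remains to cancel one factor [norm2 w], so the case of a zero remainder is treated apart. *)
have [w0|w0] := eqVneq w 0.
  have /eqP -> : norm2 w == 0 by rewrite norm2_eq0 w0.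
  by rewrite expr2 mulrA mulr_ge0 ?norm2_ge0.
have nw : 0 < norm2 w by rewrite lt_def norm2_eq0 w0 norm2_ge0.
by rewrite -(ler_pM2r nw) -expr2 wE.
Qed.

End Euclidean.

Theorem proposition1 (R : realType) (C L : R) :
  exists C' : R,
  forall (d N : nat) (sigma : nat -> R)
    (sigma_decr : forall j : nat, (j < N)%N -> sigma j.+1 < sigma j)
    (sigma_last : sigma N = 0)
    (i : nat) (i_gt0 : (0 < i)%N) (i_le : (i <= N)%N)
    (f : 'rV[R]_d -> R -> 'rV[R]_d) (x : 'rV[R]_d),
  let xE := euler_step f (sigma i.-1) (sigma i) x in
  let xH := heun_step f (sigma i.-1) (sigma i) x in
  let fi := fun y : 'rV[R]_d => f y (sigma i) in
  let J := jacobian fi xH in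
  let Delta := xH - xE in
  forall (r : R) (r_gt0 : 0 < r)
    (f_lip : lipschitz_jacobian_on fi (ball2 xH r) L)
    (Delta_neq0 : Delta != 0)
    (Delta_small : ball2 xH r xE)
    (lambda : R[i]) (lambda_dom : dominant_eigenvalue J lambda)
    (Delta_aligned :
       `| norm2 (Delta *m J) - modulus lambda * norm2 Delta |
         <= C * norm2 Delta ^+ 2),
  `| modulus lambda - norm2 (fi xH - fi xE) / norm2 Delta |
    <= C' * norm2 Delta.
Proof.
exists (C + L) => d N sigma _ _ i _ _ f x xE xH fi J Delta r _ f_lip Delta_neq0.
move=> Delta_small lambda _ aligned.
have nD : 0 < norm2 Delta by rewrite lt_def norm2_eq0 Delta_neq0 norm2_ge0.
have rem := lipschitz_jacobian_remainder fi xH xE r L f_lip Delta_small.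
have tri := le_trans (norm2_dist (fi xH - fi xE) (Delta *m J)) rem.
(* Multiplying by [norm2 Delta] clears the quotient; the goal becomes the sum of the alignment error
   and the remainder bound, both quadratic in [norm2 Delta]. *)
rewrite -(ler_pM2r nD) -[X in _ * X <= _](gtr0_norm nD) -normrM mulrBl.
rewrite divfK ?gt_eqF// -mulrA -expr2 mulrDl.
by move: aligned tri; rewrite !ler_norml => /andP[? ?] /andP[? ?];
  apply/andP; split; lra.
Qed.
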